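(* (Representation theorem.) Let $\mathbf U=\langle\langle U,\approx\rangle,\preceq\rangle$ be a completely lattice $\mathbf L$-ordered set. The mapping ${\sim}\mapsto\langle{}_\sim,{}^\sim\rangle$ is an isomorphism of $\mathbf L$-ordered sets between $\mathrm{CTol}(\mathbf U)$ and $\mathrm{EIGal}(\mathbf U)$, with inverse $\langle f,g\rangle\mapsto{\sim_{\langle f,g\rangle}}$. Moreover, $\mathrm{CTol}(\mathbf U)$ and $\mathrm{EIGal}(\mathbf U)$ are both completely lattice $\mathbf L$-ordered sets.
   Context: $\mathbf L=\langle L,\wedge,\vee,\otimes,\to,0,1\rangle$ is a complete residuated lattice: $\langle L,\wedge,\vee,0,1\rangle$ is a complete lattice, $\langle L,\otimes,1\rangle$ is a commutative monoid, and $a\otimes b\le c$ iff $a\le b\to c$. An $\mathbf L$-set in $X$ is a map $A:X\to L$; $L^X$ is the set of all of them. Graded subsethood: $S(A,B)=\bigwedge_{x\in X}(A(x)\to B(x))$; $A\approx^X B=S(A,B)\wedge S(B,A)$. A binary $\mathbf L$-relation on $X$ is an $\mathbf L$-set in $X\times X$; reflexive: $R(x,x)=1$; symmetric: $R(x,y)=R(y,x)$; transitive: $R(x,y)\otimes R(y,z)\le R(x,z)$; an $\mathbf L$-equality is reflexive, symmetric, transitive with $R(x,y)=1\Rightarrow x=y$. An $\mathbf L$-ordered set is $\mathbf U=\langle\langle U,\approx\rangle,\preceq\rangle$, $\approx$ an $\mathbf L$-equality on $U$, $\preceq$ a binary $\mathbf L$-relation on $U$ which is reflexive, transitive, compatible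 with $\approx$ ($(u\preceq v)\otimes(u\approx u')\otimes(v\approx v')\le(u'\preceq v')$), and $(u\preceq v)\wedge(v\preceq u)\le u\approx v$. Write $u\le v$ iff $(u\preceq v)=1$. For $V\in L^U$: $\mathcal L V(v)=\bigwedge_{u}(V(u)\to(v\preceq u))$, $\mathcal U V(v)=\bigwedge_{u}(V(u)\to(u\preceq v))$; $\inf V$ is the unique $u$ with $\mathcal L V(u)=1=\mathcal U(\mathcal L V)(u)$, $\sup V$ the unique $u$ with $\mathcal U V(u)=1=\mathcal L(\mathcal U V)(u)$, if they exist; $\mathbf U$ is completely lattice $\mathbf L$-ordered if they exist for all $V\in L^U$. An isomorphism of $\mathbf L$-ordered sets is a bijection $h$ with $(u_1\preceq u_2)=(h(u_1)\preceq h(u_2))$. Power relation: for a binary $\mathbf L$-relation $R$ on $X$ and $A,B\in L^X$, $(R\circ B)(x)=\bigvee_y R(x,y)\otimes B(y)$, $(A\circ R)(y)=\bigvee_x A(x)\otimes R(x,y)$, $R^+(A,B)=S(A,R\circ B)\wedge S(B,A\circ R)$. A binary $\mathbf L$-relation $R$ on $\mathbf U$ is complete if it is compatible with $\approx$ and for all $V_1,V_2\in L^U$, $R^+(V_1,V_2)\le R(\inf V_1,\inf V_2)$ and $R^+(V_1,V_2)\le R(\sup V_1,\sup V_2)$. An $\mathbf L$-tolerance is a reflexive symmetric binary $\mathbf L$-relation. $\mathrm{CTol}(\mathbf U)$ is the set of complete $\mathbf L$-tolerances on $\mathbf U$, equipped with the $\mathbf L$-equality $\approx^{U\times U}$ and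 the $\mathbf L$-order $S$. For $\sim\in\mathrm{CTol}(\mathbf U)$ and $u\in U$: $[u]_\sim(v)=u\sim v$, $u_\sim=\inf[u]_\sim$, $u^\sim=\sup[u]_\sim$. An isotone $\mathbf L$-Galois connection on $\mathbf U$ is a pair $\langle f,g\rangle$ of maps $U\to U$ with $(f(u)\preceq v)=(u\preceq g(v))$ for all $u,v$; it is extensive if $f(u)\le u$ and $g(u)\ge u$ for all $u$. $\mathrm{EIGal}(\mathbf U)$ is the set of extensive isotone $\mathbf L$-Galois connections on $\mathbf U$, equipped with $\langle f_1,g_1\rangle\approx\langle f_2,g_2\rangle=\bigwedge_u(f_2(u)\approx f_1(u))\wedge\bigwedge_v(g_1(v)\approx g_2(v))$ and $\langle f_1,g_1\rangle\preceq\langle f_2,g_2\rangle=\bigwedge_u(f_2(u)\preceq f_1(u))\wedge\bigwedge_v(g_1(v)\preceq g_2(v))$. For $\langle f,g\rangle\in\mathrm{EIGal}(\mathbf U)$, $u\sim_{\langle f,g\rangle}v=(f(u)\preceq v)\wedge(v\preceq g(u))$. *)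

(* Defs.v *)
From HB Require Import structures.
From mathcomp Require Import all_boot all_order.
From mathcomp Require Import boolp classical_sets.

Set Implicit Arguments.
Unset Strict Implicit.
Unset Printing Implicit Defensive.

Import Order.TTheory.
Local Open Scope order_scope.

Reserved Notation "a \otimes b" (at level 40, left associativity).
Reserved Notation "a \imp b" (at level 45, right associativity).
Reserved Notation "u \preceq v" (at level 60, no associativity).
Reserved Notation "u \approx v" (at level 60, no associativity).

(* The lattice operations, 0 and 1 are those of the underlying tbLatticeType:
   Order.meet, Order.join, \bot and \top.  The degenerate case 0 = 1 is
   allowed. *)
HB.mixin Record isCompleteLattice (d : Order.disp_t) L of Order.TBLattice d L := {
  linfimum : set L -> L ;
  lsupremum : set L -> L ;
  linfimumP : forall A : set L, infimums A (linfimum A) ;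
  lsupremumP : forall A : set L, supremums A (lsupremum A)
}.

#[short(type="completeLatticeType")]
HB.structure Definition CompleteLattice d :=
  { L of isCompleteLattice d L & Order.TBLattice d L }.

HB.mixin Record isResiduated (d : Order.disp_t) L of Order.TBLattice d L := {
  lmul : L -> L -> L ;
  limp : L -> L -> L ;
  lmulA : associative lmul ;
  lmulC : commutative lmul ;
  lmul1l : left_id (\top : L) lmul ;
  lresiduation : forall a b c : L, (lmul a b <= c) = (a <= limp b c)
}.

#[short(type="completeResiduatedLatticeType")]
HB.structure Definition CompleteResiduatedLattice d :=
  { L of isResiduated d L & CompleteLattice d L }.

Notation "a \otimes b" := (lmul a b) : order_scope.
Notation "a \imp b" := (limp a b) : order_scope.

Definition lset {d} (L : completeResiduatedLatticeType d) (X : Type) := X -> L.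

Definition lrel {d} (L : completeResiduatedLatticeType d) (X : Type) :=
  lset L (X * X).

Section Basics.
Context {d : Order.disp_t} {L : completeResiduatedLatticeType d}.
Implicit Types (X : Type) (a b c : L).

Definition bigmeet X (F : X -> L) : L := linfimum (range F).
Definition bigjoin X (F : X -> L) : L := lsupremum (range F).

(* Graded subsethood S(A, B). *)
Definition subsethood X (A B : lset L X) : L := bigmeet (fun x => A x \imp B x).

Definition lset_eq X (A B : lset L X) : L :=
  Order.meet (subsethood A B) (subsethood B A).

Definition lreflexive X (R : lrel L X) := forall x, R (x, x) = \top.

Definition lsymmetric X (R : lrel L X) := forall x y, R (x, y) = R (y, x).

Definition ltransitive X (R : lrel L X) :=
  forall x y z, R (x, y) \otimes R (y, z) <= R (x, z).

Definition lequality X (R : lrel L X) :=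
  [/\ lreflexive R, lsymmetric R, ltransitive R
    & forall x y, R (x, y) = \top -> x = y].

Definition compatible X (E R : lrel L X) :=
  forall u v u' v',
    R (u, v) \otimes E (u, u') \otimes E (v, v') <= R (u', v').

Definition ltolerance X (R : lrel L X) := lreflexive R /\ lsymmetric R.

(* The compositions R o B and A o R, and the power relation R^+. *)
Definition comp_left X (R : lrel L X) (B : lset L X) : lset L X :=
  fun x => bigjoin (fun y => R (x, y) \otimes B y).

Definition comp_right X (A : lset L X) (R : lrel L X) : lset L X :=
  fun y => bigjoin (fun x => A x \otimes R (x, y)).

Definition power_rel X (R : lrel L X) (A B : lset L X) : L :=
  Order.meet (subsethood A (comp_left R B)) (subsethood B (comp_right A R)).

End Basics.

Record lOrderedSet {d} (L : completeResiduatedLatticeType d) := LOrderedSet {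
  lcarrier :> Type ;
  lapprox : lrel L lcarrier ;
  lpreceq : lrel L lcarrier ;
  lapprox_equality : lequality lapprox ;
  lpreceq_refl : lreflexive lpreceq ;
  lpreceq_trans : ltransitive lpreceq ;
  lpreceq_compat : compatible lapprox lpreceq ;
  lpreceq_antisym : forall u v,
    Order.meet (lpreceq (u, v)) (lpreceq (v, u)) <= lapprox (u, v)
}.

Notation "u \preceq v" := (lpreceq (u, v)) : order_scope.
Notation "u \approx v" := (lapprox (u, v)) : order_scope.

Section OrderedSets.
Context {d : Order.disp_t} {L : completeResiduatedLatticeType d}.
Implicit Type U : lOrderedSet L.

(* The crisp order u <= v. *)
Definition crisp_le U (u v : U) : Prop := (u \preceq v) = \top.

Definition lower_cone U (V : lset L U) : lset L U :=
  fun v => bigmeet (fun u => V u \imp (v \preceq u)).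

Definition upper_cone U (V : lset L U) : lset L U :=
  fun v => bigmeet (fun u => V u \imp (u \preceq v)).

Definition is_inf U (V : lset L U) (u : U) : Prop :=
  lower_cone V u = \top /\ upper_cone (lower_cone V) u = \top.

Definition is_sup U (V : lset L U) (u : U) : Prop :=
  upper_cone V u = \top /\ lower_cone (upper_cone V) u = \top.

Definition completely_lattice_ordered U : Prop :=
  forall V : lset L U, (exists! u, is_inf V u) /\ (exists! u, is_sup V u).

Definition inf_of U (HU : completely_lattice_ordered U) (V : lset L U) : U :=
  projT1 (cid (proj1 (HU V))).

Definition sup_of U (HU : completely_lattice_ordered U) (V : lset L U) : U :=
  projT1 (cid (proj2 (HU V))).

Definition lisomorphism U1 U2 (h : U1 -> U2) : Prop :=
  bijective h /\ forall u v : U1, (u \preceq v) = (h u \preceq h v).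

Definition complete_rel U (HU : completely_lattice_ordered U) (R : lrel L U) :=
  compatible (@lapprox _ _ U) R /\
  forall V1 V2 : lset L U,
    power_rel R V1 V2 <= R (inf_of HU V1, inf_of HU V2) /\
    power_rel R V1 V2 <= R (sup_of HU V1, sup_of HU V2).

Definition lclass U (R : lrel L U) (u : U) : lset L U := fun v => R (u, v).

Definition isotone_galois U (fg : (U -> U) * (U -> U)) : Prop :=
  forall u v, (fg.1 u \preceq v) = (u \preceq fg.2 v).

Definition extensive U (fg : (U -> U) * (U -> U)) : Prop :=
  forall u, crisp_le (fg.1 u) u /\ crisp_le u (fg.2 u).

End OrderedSets.

Section Constructions.
Context {d : Order.disp_t} {L : completeResiduatedLatticeType d}.
Implicit Types (a b : L) (X : Type).

Lemma bigmeet_le X (F : X -> L) x : bigmeet F <= F x.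
Proof. by have [+ _] := linfimumP (range F); apply; exists x. Qed.

Lemma le_bigmeet X (F : X -> L) a : (forall x, a <= F x) -> a <= bigmeet F.
Proof.
by move=> aF; have [_] := linfimumP (range F); apply => _ [x _ <-].
Qed.

Lemma lmul_mono a a' b b' : a <= a' -> b <= b' -> a \otimes b <= a' \otimes b'.
Proof.
move=> aa' bb'; rewrite lresiduation (le_trans aa')// -lresiduation lmulC.
by rewrite lresiduation (le_trans bb')// -lresiduation lmulC.
Qed.

Lemma limp_top a b : (a \imp b == \top) = (a <= b).
Proof. by rewrite -le1x -lresiduation lmul1l. Qed.

Lemma bigmeet_top X (F : X -> L) : bigmeet F = \top -> forall x, F x = \top.
Proof. by move=> F1 x; apply/eqP; rewrite -le1x -F1 bigmeet_le. Qed.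

Lemma meet_top a b : Order.meet a b = \top -> a = \top /\ b = \top.
Proof. by move/eqP; rewrite meet_eq1 => /andP[/eqP-> /eqP->]. Qed.

Section FromPreorder.
Variables (T : Type) (E R : lrel L T).
Hypothesis R_refl : lreflexive R.
Hypothesis R_trans : ltransitive R.
Hypothesis ER : forall x y, E (x, y) = Order.meet (R (x, y)) (R (y, x)).
Hypothesis E_eq : forall x y, E (x, y) = \top -> x = y.

Lemma preorder_equality : lequality E.
Proof.
split=> //.
- by move=> x; rewrite ER !R_refl meetxx.
- by move=> x y; rewrite !ER meetC.
- move=> x y z; rewrite !ER lexI; apply/andP; split.
    by apply: le_trans (R_trans x y z); apply: lmul_mono; rewrite leIl.
  apply: le_trans (R_trans z y x); rewrite lmulC.
  by apply: lmul_mono; rewrite leIr.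
Qed.

Lemma preorder_compat : compatible E R.
Proof.
move=> u v u' v'; apply: le_trans (R_trans u' v v').
apply: lmul_mono; last by rewrite ER leIl.
apply: le_trans (R_trans u' u v); rewrite lmulC.
by apply: lmul_mono => //; rewrite ER leIr.
Qed.

Lemma preorder_antisym u v : Order.meet (R (u, v)) (R (v, u)) <= E (u, v).
Proof. by rewrite ER. Qed.

Definition lOrderedSet_of_preorder : lOrderedSet L :=
  LOrderedSet preorder_equality R_refl R_trans preorder_compat preorder_antisym.

End FromPreorder.

Lemma subsethood_refl X (A : lset L X) : subsethood A A = \top.
Proof.
apply/eqP; rewrite -le1x; apply: le_bigmeet => x.
by rewrite le1x limp_top.
Qed.

Lemma subsethood_trans X (A B C : lset L X) :
  subsethood A B \otimes subsethood B C <= subsethood A C.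
Proof.
apply: le_bigmeet => x; rewrite -lresiduation.
rewrite (lmulC (subsethood A B)) -lmulA.
apply: (@le_trans _ _ (subsethood B C \otimes B x)).
  by apply: lmul_mono => //; rewrite lresiduation; exact: bigmeet_le.
by rewrite lresiduation; exact: bigmeet_le.
Qed.

Lemma lset_eq_top X (A B : lset L X) : lset_eq A B = \top -> A = B.
Proof.
move=> /meet_top[/bigmeet_top AB /bigmeet_top BA]; apply: funext => x.
by apply/eqP; rewrite eq_le -!limp_top AB BA eqxx.
Qed.

Lemma approxE (U : lOrderedSet L) (u v : U) :
  (u \approx v) = Order.meet (u \preceq v) (v \preceq u).
Proof.
have [Er Es _ _] := lapprox_equality U.
apply/eqP; rewrite eq_le lpreceq_antisym andbT lexI; apply/andP; split.
  have := lpreceq_compat u u u v.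
  by rewrite lpreceq_refl lmul1l Er lmul1l.
have := lpreceq_compat u u v u.
by rewrite lpreceq_refl lmul1l Er lmulC lmul1l.
Qed.

Section CTol.
Variables (U : lOrderedSet L) (HU : completely_lattice_ordered U).

Definition ctol : Type :=
  {R : lrel L U | ltolerance R /\ complete_rel HU R}.

Definition ctol_approx : lrel L ctol :=
  fun p => lset_eq (sval p.1) (sval p.2).

Definition ctol_preceq : lrel L ctol :=
  fun p => subsethood (sval p.1) (sval p.2).

Lemma ctol_refl : lreflexive ctol_preceq.
Proof. by move=> R; exact: subsethood_refl. Qed.

Lemma ctol_trans : ltransitive ctol_preceq.
Proof. by move=> R1 R2 R3; exact: subsethood_trans. Qed.

Lemma ctol_approxE R1 R2 : ctol_approx (R1, R2) =
  Order.meet (ctol_preceq (R1, R2)) (ctol_preceq (R2, R1)).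
Proof. by []. Qed.

Lemma ctol_eq R1 R2 : ctol_approx (R1, R2) = \top -> R1 = R2.
Proof. by case: R1 R2 => [R1 H1] [R2 H2] /lset_eq_top H; apply: eq_exist. Qed.

Definition CTol : lOrderedSet L :=
  lOrderedSet_of_preorder ctol_refl ctol_trans ctol_approxE ctol_eq.

End CTol.

Section EIGal.
Variable U : lOrderedSet L.

Definition eigal : Type :=
  {fg : (U -> U) * (U -> U) | isotone_galois fg /\ extensive fg}.

Definition eig_lower (c : eigal) : U -> U := (sval c).1.
Definition eig_upper (c : eigal) : U -> U := (sval c).2.

(* The first components are compared in the reverse order. *)
Definition eigal_approx : lrel L eigal := fun p =>
  Order.meet (bigmeet (fun u => eig_lower p.2 u \approx eig_lower p.1 u))
             (bigmeet (fun v => eig_upper p.1 v \approx eig_upper p.2 v)).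

Definition eigal_preceq : lrel L eigal := fun p =>
  Order.meet (bigmeet (fun u => eig_lower p.2 u \preceq eig_lower p.1 u))
             (bigmeet (fun v => eig_upper p.1 v \preceq eig_upper p.2 v)).

Lemma eigal_refl : lreflexive eigal_preceq.
Proof.
move=> c; apply/eqP; rewrite -le1x lexI; apply/andP.
by split; apply: le_bigmeet => u; rewrite lpreceq_refl.
Qed.

Lemma eigal_trans : ltransitive eigal_preceq.
Proof.
move=> c1 c2 c3; rewrite lexI; apply/andP; split; apply: le_bigmeet => u.
  rewrite lmulC; apply: le_trans (lpreceq_trans _ (eig_lower c2 u) _).
  by apply: lmul_mono; apply: le_trans (leIl _ _) (bigmeet_le _ u).
apply: le_trans (lpreceq_trans _ (eig_upper c2 u) _).
by apply: lmul_mono; apply: le_trans (leIr _ _) (bigmeet_le _ u).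
Qed.

Lemma eigal_approxE c1 c2 : eigal_approx (c1, c2) =
  Order.meet (eigal_preceq (c1, c2)) (eigal_preceq (c2, c1)).
Proof.
apply/eqP; rewrite eq_le; apply/andP; split; rewrite !lexI.
  apply/andP; split; apply/andP; split; apply: le_bigmeet => u.
  - by apply: le_trans (leIl _ _) (le_trans (bigmeet_le _ u) _);
      rewrite approxE leIl.
  - by apply: le_trans (leIr _ _) (le_trans (bigmeet_le _ u) _);
      rewrite approxE leIl.
  - by apply: le_trans (leIl _ _) (le_trans (bigmeet_le _ u) _);
      rewrite approxE leIr.
  - by apply: le_trans (leIr _ _) (le_trans (bigmeet_le _ u) _);
      rewrite approxE leIr.
apply/andP; split; apply: le_bigmeet => u; rewrite approxE lexI /=;
  apply/andP; split.
- exact: le_trans (leIl _ _) (le_trans (leIl _ _) (bigmeet_le _ u)).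
- exact: le_trans (leIr _ _) (le_trans (leIl _ _) (bigmeet_le _ u)).
- exact: le_trans (leIl _ _) (le_trans (leIr _ _) (bigmeet_le _ u)).
- exact: le_trans (leIr _ _) (le_trans (leIr _ _) (bigmeet_le _ u)).
Qed.

Lemma eigal_eq c1 c2 : eigal_approx (c1, c2) = \top -> c1 = c2.
Proof.
have [_ _ _ Eeq] := lapprox_equality U.
case: c1 c2 => [[f1 g1] H1] [[f2 g2] H2].
move=> /meet_top[/bigmeet_top f12 /bigmeet_top g12].
apply: eq_exist; congr pair; apply: funext => u.
- by apply/esym/Eeq; exact: f12.
- by apply: Eeq; exact: g12.
Qed.

Definition EIGal : lOrderedSet L :=
  lOrderedSet_of_preorder eigal_refl eigal_trans eigal_approxE eigal_eq.

(* The relation ~_<f,g>. *)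
Definition galois_rel (fg : (U -> U) * (U -> U)) : lrel L U := fun p =>
  Order.meet (fg.1 p.1 \preceq p.2) (p.2 \preceq fg.2 p.1).

End EIGal.

(* The pair <_~, ^~>, before it is shown to be a Galois connection. *)
Definition class_bounds (U : lOrderedSet L) (HU : completely_lattice_ordered U)
    (R : lrel L U) : (U -> U) * (U -> U) :=
  (fun u => inf_of HU (lclass R u), fun u => sup_of HU (lclass R u)).

End Constructions.

(* Main.v *)
(** The key to the representation is that a complete tolerance [R] is recovered
    from the bounds of its classes.  With [f u = inf [u]_R] and
    [g u = sup [u]_R], completeness gives [R(u, f u) = R(u, g u) = 1].  If
    [f u <= v] to degree [a], take the supremum of [v] and of [u] with weight
    [a]; the supremum of [v] and of [f u] with weight [a] is [v] itself, so
    completeness makes [v] related to that weighted join [w], which lies above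
    [u] to degree [a].  As [w <= g v], this yields the Galois property.  If
    also [v <= g u] to degree [a], the dual construction applied to [w] and [u]
    with weight [a] returns an element equal to [u] to degree [a] and related to
    [v], whence [a <= R(u, v)].  Arbitrary graded intersections of complete
    tolerances are complete tolerances, which gives the completeness claims. *)
Require Import Defs.
From mathcomp Require Import all_boot all_order.
From mathcomp Require Import boolp classical_sets.

Set Implicit Arguments.
Unset Strict Implicit.
Unset Printing Implicit Defensive.

Import Order.TTheory.
Local Open Scope order_scope.

(** * Residuation, graded meets and joins, and the power relation *)

Section Residuation.
Context {d : Order.disp_t} {L : completeResiduatedLatticeType d}.
Implicit Types (a b c : L) (X : Type).

Lemma eq_top a : \top <= a -> a = \top.
Proof. by rewrite le1x => /eqP. Qed.

Lemma lmul1r a : a \otimes \top = a.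
Proof. by rewrite lmulC lmul1l. Qed.

Lemma limp_mp a b : (a \imp b) \otimes a <= b.
Proof. by rewrite lresiduation. Qed.

Lemma limp1l a : \top \imp a = a.
Proof.
apply/eqP; rewrite eq_le -[X in X <= a]lmul1r limp_mp.
by rewrite -lresiduation lmul1r lexx.
Qed.

Lemma bigmeetP X (F : X -> L) a : a <= bigmeet F <-> forall x, a <= F x.
Proof.
by split=> [aF x|]; [exact: le_trans aF (bigmeet_le _ _)|exact: le_bigmeet].
Qed.

Lemma le_bigjoin X (F : X -> L) x a : a <= F x -> a <= bigjoin F.
Proof.
move=> /le_trans; apply.
by have [+ _] := lsupremumP (range F); apply; exists x.
Qed.

Lemma bigjoin_le X (F : X -> L) a : (forall x, F x <= a) -> bigjoin F <= a.
Proof.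
by move=> Fa; have [_] := lsupremumP (range F); apply => _ [x _ <-].
Qed.

Lemma lmul_bigjoin_le X (F : X -> L) a b :
  (forall x, a \otimes F x <= b) -> a \otimes bigjoin F <= b.
Proof.
move=> Fab; rewrite lmulC lresiduation; apply: bigjoin_le => x.
by rewrite -lresiduation lmulC.
Qed.

Lemma limp_antitone a b c : (a <= b \imp c) = (b <= a \imp c).
Proof. by rewrite -!lresiduation lmulC. Qed.

Lemma subsethood_mp X (A B : lset L X) x : subsethood A B \otimes A x <= B x.
Proof. by rewrite lresiduation; exact: bigmeet_le. Qed.

Lemma power_rel_sym X (R : lrel L X) (A B : lset L X) :
  lsymmetric R -> power_rel R A B = power_rel R B A.
Proof.
move=> Rsym; have compE C : comp_left R C = comp_right C R.
  apply: funext => x; congr bigjoin; apply: funext => y.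
  by rewrite lmulC Rsym.
by rewrite /power_rel meetC !compE.
Qed.

End Residuation.

(** * The opposite [L]-order, which turns results on suprema into results on infima *)

Section Dual.
Context {d : Order.disp_t} {L : completeResiduatedLatticeType d}.
Variable U : lOrderedSet L.

Definition dual_preceq : lrel L U := fun p => p.2 \preceq p.1.

Lemma dual_trans : ltransitive dual_preceq.
Proof. by move=> u v w; rewrite lmulC; exact: lpreceq_trans. Qed.

Lemma dual_compat : compatible (@lapprox _ _ U) dual_preceq.
Proof.
move=> u v u' v'; rewrite -lmulA [X in _ \otimes X]lmulC lmulA.
exact: lpreceq_compat.
Qed.

Lemma dual_antisym u v :
  Order.meet (dual_preceq (u, v)) (dual_preceq (v, u)) <= (u \approx v).
Proof. by rewrite meetC; exact: lpreceq_antisym. Qed.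

(* The cones, infima and suprema of the dual are convertible to the upper and
   lower cones, suprema and infima of [U]. *)
Definition ldual : lOrderedSet L :=
  @LOrderedSet _ _ U (@lapprox _ _ U) dual_preceq (lapprox_equality U)
    (@lpreceq_refl _ _ U) dual_trans dual_compat dual_antisym.

End Dual.

(** * Suprema, infima and criteria for completeness *)

Section Bounds.
Context {d : Order.disp_t} {L : completeResiduatedLatticeType d}.

Lemma approx_refl (U : lOrderedSet L) (u : U) : (u \approx u) = \top.
Proof. by have [+ _ _ _] := lapprox_equality U; apply. Qed.

Lemma preceq_trans_le (U : lOrderedSet L) (u v w : U) (a b : L) :
  a <= (u \preceq v) -> b <= (v \preceq w) -> a \otimes b <= (u \preceq w).
Proof. by move=> ha hb; exact: le_trans (lmul_mono ha hb) (lpreceq_trans _ _ _). Qed.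

Lemma preceq_anti (U : lOrderedSet L) (u v : U) :
  (u \preceq v) = \top -> (v \preceq u) = \top -> u = v.
Proof.
move=> uv vu; have [_ _ _] := lapprox_equality U; apply.
by apply: eq_top; rewrite approxE uv vu meetxx.
Qed.

(** The universal property of the supremum. One inequality is transitivity through [s]; the other
    says that [s] lies in the lower cone of the upper cone. *)
Lemma is_supP (U : lOrderedSet L) (V : lset L U) s :
  is_sup V s <-> forall t, (s \preceq t) = upper_cone V t.
Proof.
split=> [[Vs Us] t|sE].
  apply/eqP; rewrite eq_le; apply/andP; split.
    apply/bigmeetP => u; rewrite -lresiduation lmulC.
    apply: preceq_trans_le => //; rewrite -limp_top.
    by apply/eqP; exact: (bigmeet_top Vs).
  by rewrite -limp_top; apply/eqP; exact: (bigmeet_top Us).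
have Vs : upper_cone V s = \top by rewrite -sE lpreceq_refl.
split=> //; apply: eq_top; apply/bigmeetP => t.
by rewrite -sE le1x limp_top.
Qed.

Lemma is_infP (U : lOrderedSet L) (V : lset L U) m :
  is_inf V m <-> forall t, (t \preceq m) = lower_cone V t.
Proof. exact: (@is_supP (ldual U)). Qed.

Lemma is_sup_uniq (U : lOrderedSet L) (V : lset L U) s s' :
  is_sup V s -> is_sup V s' -> s = s'.
Proof.
move=> /is_supP sE /is_supP s'E.
by apply: preceq_anti; [rewrite sE -s'E|rewrite s'E -sE];
  exact: lpreceq_refl.
Qed.

Lemma is_inf_uniq (U : lOrderedSet L) (V : lset L U) m m' :
  is_inf V m -> is_inf V m' -> m = m'.
Proof. exact: (@is_sup_uniq (ldual U)). Qed.

Lemma is_sup_ub (U : lOrderedSet L) (V : lset L U) s u :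
  is_sup V s -> V u <= (u \preceq s).
Proof. by case=> /bigmeet_top/(_ u)/eqP; rewrite limp_top. Qed.

Lemma is_inf_lb (U : lOrderedSet L) (V : lset L U) m u :
  is_inf V m -> V u <= (m \preceq u).
Proof. exact: (@is_sup_ub (ldual U)). Qed.

Lemma is_sup_max (U : lOrderedSet L) (V : lset L U) s :
  V s = \top -> (forall u, V u <= (u \preceq s)) -> is_sup V s.
Proof.
move=> Vs ub; split; apply: eq_top; apply/bigmeetP => u.
  by rewrite le1x limp_top ub.
rewrite le1x limp_top; apply: le_trans (bigmeet_le _ s) _.
by rewrite Vs limp1l.
Qed.

Lemma is_inf_min (U : lOrderedSet L) (V : lset L U) m :
  V m = \top -> (forall u, V u <= (m \preceq u)) -> is_inf V m.
Proof. exact: (@is_sup_max (ldual U)). Qed.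

Lemma is_sup_singleton (U : lOrderedSet L) (u : U) :
  is_sup (fun v => u \approx v) u.
Proof.
apply: is_sup_max; first exact: approx_refl.
by move=> v; rewrite approxE leIr.
Qed.

(** Residuation gives [V u <= (upper_cone V t \imp (u \preceq t))] for all [t], so [u] is below the
    infimum [s] to degree [V u]. Existence of infima therefore suffices for completeness. *)
Lemma is_sup_inf_upper_cone (U : lOrderedSet L) (V : lset L U) s :
  is_inf (upper_cone V) s -> is_sup V s.
Proof.
move=> sinf; split; last by case: sinf.
apply: eq_top; apply/bigmeetP => u; rewrite le1x limp_top.
have /is_infP -> := sinf; apply/bigmeetP => t.
by rewrite limp_antitone; exact: bigmeet_le.
Qed.

Lemma completely_lattice_ordered_inf (U : lOrderedSet L) :
  (forall V : lset L U, exists m, is_inf V m) -> completely_lattice_ordered U.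
Proof.
move=> infU V; split.
  by have [m mV] := infU V; exists m; split=> // m'; exact: is_inf_uniq.
have [s /is_sup_inf_upper_cone sV] := infU (upper_cone V).
by exists s; split=> // s'; exact: is_sup_uniq.
Qed.

Lemma inf_ofP (U : lOrderedSet L) (HU : completely_lattice_ordered U) V :
  is_inf V (inf_of HU V).
Proof. by rewrite /inf_of; case: cid => m []. Qed.

Lemma sup_ofP (U : lOrderedSet L) (HU : completely_lattice_ordered U) V :
  is_sup V (sup_of HU V).
Proof. by rewrite /sup_of; case: cid => m []. Qed.

Lemma completely_lattice_ordered_iso (U1 U2 : lOrderedSet L)
    (h : U1 -> U2) (k : U2 -> U1) :
  cancel h k -> cancel k h ->
  (forall u v, (u \preceq v) = (h u \preceq h v)) ->
  completely_lattice_ordered U1 -> completely_lattice_ordered U2.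
Proof.
move=> hK kK hP HU1; apply: completely_lattice_ordered_inf => V.
have [[m [/is_infP mE _]] _] := HU1 (V \o h).
exists (h m); apply/is_infP => t.
rewrite -[t in LHS]kK -hP mE; apply/eqP; rewrite eq_le.
apply/andP; split; apply/bigmeetP => u.
  by apply: le_trans (bigmeet_le _ (k u)) _; rewrite /= hP !kK.
by apply: le_trans (bigmeet_le _ (h u)) _; rewrite /= hP !kK.
Qed.

End Bounds.

(** * [L]-sets generated by points with weights *)

Section WeightedFamilies.
Context {d : Order.disp_t} {L : completeResiduatedLatticeType d}.
Variables (U : lOrderedSet L) (I : Type) (c : I -> L).

Definition weighted_family (p : I -> U) : lset L U :=
  fun z => bigjoin (fun i => c i \otimes (p i \approx z)).

(** Spreading the weights along [\approx] leaves the upper bounds unchanged, since [z \preceq p i]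
    and [p i \preceq t] compose. *)
Lemma upper_cone_weighted_family (p : I -> U) t :
  upper_cone (weighted_family p) t = bigmeet (fun i => c i \imp (p i \preceq t)).
Proof.
apply/eqP; rewrite eq_le; apply/andP; split; apply/bigmeetP.
  move=> i; apply: le_trans (bigmeet_le _ (p i)) _.
  rewrite limp_antitone; apply: le_trans (_ : weighted_family p (p i) <= _).
    by apply: (le_bigjoin (x := i)); rewrite approx_refl lmul1r.
  by rewrite -limp_antitone.
move=> z; rewrite limp_antitone; apply: bigjoin_le => i.
rewrite -limp_antitone; apply: le_trans (bigmeet_le _ i) _.
rewrite -lresiduation lmulA lmulC; apply: preceq_trans_le (limp_mp _ _).
by rewrite approxE leIr.
Qed.

(** By compatibility, a point equal to [p i] to some degree is related to [q i] to at least that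
    degree, and [q i] has weight at least [c i] in its own family. *)
Lemma power_rel_weighted_family (R : lrel L U) (p q : I -> U) :
  lsymmetric R -> compatible (@lapprox _ _ U) R ->
  (forall i, R (p i, q i) = \top) ->
  power_rel R (weighted_family p) (weighted_family q) = \top.
Proof.
move=> Rsym Rcompat Rpq; rewrite /power_rel.
have half r s z i : R (r i, s i) = \top ->
    c i \otimes (r i \approx z) <= R (z, s i) \otimes weighted_family s (s i).
  move=> Rrs; rewrite lmulC; apply: lmul_mono.
    have := Rcompat (r i) (s i) z (s i).
    by rewrite Rrs lmul1l approx_refl lmul1r.
  by apply: (le_bigjoin (x := i)); rewrite approx_refl lmul1r.
apply: eq_top; rewrite lexI.
apply/andP; split; apply/bigmeetP => z; rewrite le1x limp_top;
  apply: bigjoin_le => i.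
  by apply: (le_bigjoin (x := q i)); exact: half.
apply: (le_bigjoin (x := p i)); rewrite [leRHS]lmulC Rsym.
by apply: half; rewrite Rsym.
Qed.

End WeightedFamilies.

(** * Consequences of compatibility with suprema *)

Section TolerancesPreservingSuprema.
Context {d : Order.disp_t} {L : completeResiduatedLatticeType d}.

(** Quantifying over all suprema, without a choice of [sup_of], makes this condition on [ldual U]
    convertible to [inf_preserving] on [U]. *)
Definition sup_preserving (U : lOrderedSet L) (R : lrel L U) :=
  forall V1 V2 s1 s2, is_sup V1 s1 -> is_sup V2 s2 ->
    power_rel R V1 V2 <= R (s1, s2).

Definition inf_preserving (U : lOrderedSet L) (R : lrel L U) :=
  forall V1 V2 m1 m2, is_inf V1 m1 -> is_inf V2 m2 ->
    power_rel R V1 V2 <= R (m1, m2).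

(** [u] is the supremum of its own singleton, and that singleton is in full power relation with the
    class of [u]. *)
Lemma rel_sup_lclass (U : lOrderedSet L) (R : lrel L U) u g :
  ltolerance R -> compatible (@lapprox _ _ U) R -> sup_preserving R ->
  is_sup (lclass R u) g -> R (u, g) = \top.
Proof.
move=> [Rrefl Rsym] Rcompat Rsup gE; apply: eq_top.
apply: le_trans (Rsup _ _ _ _ (is_sup_singleton u) gE).
rewrite lexI; apply/andP; split; apply/bigmeetP => x; rewrite le1x limp_top.
  apply: (le_bigjoin (x := x)); rewrite Rrefl lmul1l.
  have := Rcompat u u u x.
  by rewrite Rrefl approx_refl !lmul1l.
by apply: (le_bigjoin (x := u)); rewrite approx_refl lmul1l.
Qed.

(** Compare [v] and [x] with weights 1 and [a] to [v'] and [u] with the same weights. The first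
    family has supremum [v], because [x] is absorbed to degree [a]; the second has supremum [w].
    Allowing [v'] to differ from [v] permits a second, dual application that starts from [w]. *)
Lemma rel_weighted_join (U : lOrderedSet L) (R : lrel L U) (u v v' x : U) (a : L) :
  (forall V : lset L U, exists s, is_sup V s) ->
  ltolerance R -> compatible (@lapprox _ _ U) R -> sup_preserving R ->
  R (x, u) = \top -> R (v, v') = \top -> a <= (x \preceq v) ->
  exists w, R (v, w) = \top /\
    forall t, (w \preceq t) = Order.meet (v' \preceq t) (a \imp (u \preceq t)).
Proof.
move=> supU [Rrefl Rsym] Rcompat Rsup Rxu Rvv' axv.
pose c b : L := if b then \top else a.
pose p y1 y b : U := if b then y1 else y.
have coneE y1 y t : upper_cone (weighted_family c (p y1 y)) t =
    Order.meet (y1 \preceq t) (a \imp (y \preceq t)).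
  rewrite upper_cone_weighted_family; apply/eqP; rewrite eq_le lexI.
  apply/andP; split; last first.
    by apply/bigmeetP => -[]; rewrite /c /p /= ?limp1l ?leIl ?leIr.
  rewrite (le_trans (bigmeet_le _ true)) /= ?limp1l//.
  by rewrite (le_trans (bigmeet_le _ false)).
have vE : is_sup (weighted_family c (p v x)) v.
  apply/is_supP => t; rewrite coneE; apply/esym/meet_idPl.
  by rewrite -lresiduation lmulC; exact: preceq_trans_le axv (lexx _).
have [w wE] := supU (weighted_family c (p v' u)); exists w; split.
  apply: eq_top; apply: le_trans (Rsup _ _ _ _ vE wE).
  by rewrite power_rel_weighted_family// => -[] /=.
by move=> t; have /is_supP -> := wE.
Qed.

Lemma le_galois_of_tolerance (U : lOrderedSet L) (R : lrel L U) u v f g :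
  (forall V : lset L U, exists s, is_sup V s) ->
  ltolerance R -> compatible (@lapprox _ _ U) R -> sup_preserving R ->
  R (u, f) = \top -> is_sup (lclass R v) g ->
  (f \preceq v) <= (u \preceq g).
Proof.
move=> supU Rtol Rcompat Rsup Ruf gE.
have Rfu : R (f, u) = \top by case: Rtol => _ ->.
have [w [Rvw wE]] :=
  rel_weighted_join supU Rtol Rcompat Rsup Rfu (Rtol.1 v) (lexx _).
rewrite -[X in X <= _]lmul1r; apply: (@preceq_trans_le _ _ _ _ w).
  (* At [t = w] the left side of [wE] is [\top], so the weight, here [f \preceq v], is at most
     [u \preceq w]. *)
  have /esym := wE w; rewrite lpreceq_refl => /meet_top[_ /eqP].
  by rewrite limp_top.
by rewrite -Rvw; exact: (is_sup_ub w gE).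
Qed.

End TolerancesPreservingSuprema.

(** * From complete tolerances to extensive Galois connections *)

Section ToleranceToGalois.
Context {d : Order.disp_t} {L : completeResiduatedLatticeType d}.
Variables (U : lOrderedSet L) (HU : completely_lattice_ordered U).
Variable R : lrel L U.
Hypotheses (Rtol : ltolerance R) (Rcomplete : complete_rel HU R).

Let Rrefl : lreflexive R := proj1 Rtol.
Let Rsym : lsymmetric R := proj2 Rtol.
Let Rcompat : compatible (@lapprox _ _ U) R := proj1 Rcomplete.
Let f := (class_bounds HU R).1.
Let g := (class_bounds HU R).2.

Let supU (V : lset L U) : exists s, is_sup V s.
Proof. by exists (sup_of HU V); exact: sup_ofP. Qed.

Let infU (V : lset L U) : exists m, is_inf V m.
Proof. by exists (inf_of HU V); exact: inf_ofP. Qed.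

Let Rsup : sup_preserving R.
Proof.
move=> V1 V2 s1 s2 s1E s2E.
rewrite (is_sup_uniq s1E (sup_ofP HU V1)) (is_sup_uniq s2E (sup_ofP HU V2)).
by case: Rcomplete => _ /(_ V1 V2)[].
Qed.

Let Rinf : inf_preserving R.
Proof.
move=> V1 V2 s1 s2 s1E s2E.
rewrite (is_inf_uniq s1E (inf_ofP HU V1)) (is_inf_uniq s2E (inf_ofP HU V2)).
by case: Rcomplete => _ /(_ V1 V2)[].
Qed.

Let fE u : is_inf (lclass R u) (f u). Proof. exact: inf_ofP. Qed.
Let gE u : is_sup (lclass R u) (g u). Proof. exact: sup_ofP. Qed.

Lemma rel_class_lower u : R (u, f u) = \top.
Proof.
exact: (@rel_sup_lclass _ _ (ldual U) _ _ _ Rtol Rcompat Rinf (fE u)).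
Qed.

Lemma rel_class_upper u : R (u, g u) = \top.
Proof. exact: (rel_sup_lclass Rtol Rcompat Rsup (gE u)). Qed.

Lemma class_bounds_galois : isotone_galois (class_bounds HU R).
Proof.
move=> u v; apply/eqP; rewrite eq_le.
rewrite (le_galois_of_tolerance supU Rtol Rcompat Rsup (rel_class_lower u) (gE v)).
(* The reverse inequality is the same lemma in the opposite order, with [u] and [v] exchanged. *)
exact: (@le_galois_of_tolerance _ _ (ldual U) R _ _ _ _ infU Rtol Rcompat Rinf
  (rel_class_upper v) (fE u)).
Qed.

Lemma class_bounds_extensive : extensive (class_bounds HU R).
Proof.
move=> u; split; apply: eq_top; rewrite -(Rrefl u).
  exact: (is_inf_lb u (fE u)).
exact: (is_sup_ub u (gE u)).
Qed.

Lemma galois_rel_class_bounds : galois_rel (class_bounds HU R) = R.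
Proof.
apply: funext => -[u v]; rewrite /galois_rel /= -/f -/g.
apply/eqP; rewrite eq_le; apply/andP; split; last first.
  rewrite lexI; apply/andP; split; first exact: (is_inf_lb v (fE u)).
  exact: (is_sup_ub v (gE u)).
set a := Order.meet _ _.
have Rfu : R (f u, u) = \top by rewrite Rsym rel_class_lower.
have Rgu : R (g u, u) = \top by rewrite Rsym rel_class_upper.
have av : a <= (f u \preceq v) by exact: leIl.
have va : a <= (v \preceq g u) by exact: leIr.
have [w [Rvw wE]] := rel_weighted_join supU Rtol Rcompat Rsup Rfu (Rrefl v) av.
have auw : a <= (u \preceq w).
  have /esym := wE w; rewrite lpreceq_refl => /meet_top[_ /eqP].
  by rewrite limp_top.
(* In the opposite order, [v] absorbs [g u] to degree [a]; replacing [v] by [w] and [g u] by [u]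
   gives the meet [z] of [w] and weighted [u]. *)
have [z [Rvz zE]] : exists z : U, R (v, z) = \top /\
    forall t : U, (t \preceq z) = Order.meet (t \preceq w) (a \imp (t \preceq u)).
  exact: (@rel_weighted_join _ _ (ldual U) R u v w (g u) a
    infU Rtol Rcompat Rinf Rgu Rvw va).
have azu : a <= (z \approx u).
  have /esym := zE z; rewrite lpreceq_refl => /meet_top[_ /eqP].
  rewrite limp_top approxE lexI => -> /=.
  by rewrite zE lexI auw -lresiduation lpreceq_refl lex1.
(* Compatibility replaces [z] by [u] in [R (v, z) = \top] at the cost of [z \approx u], which is at
   least [a]. *)
have := Rcompat v z v u; rewrite Rvz approx_refl !lmul1l.
rewrite Rsym; exact: le_trans.
Qed.

Lemma class_bounds_eigal :
  isotone_galois (class_bounds HU R) /\ extensive (class_bounds HU R).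
Proof. by split; [exact: class_bounds_galois|exact: class_bounds_extensive]. Qed.

End ToleranceToGalois.

(** * From extensive Galois connections to complete tolerances *)

Section GaloisToTolerance.
Context {d : Order.disp_t} {L : completeResiduatedLatticeType d}.
Variables (U : lOrderedSet L) (fg : (U -> U) * (U -> U)).
Hypotheses (galois : isotone_galois fg) (ext : extensive fg).

Let f := fg.1.
Let g := fg.2.
Let R := galois_rel fg.

Let f_mono u v : (u \preceq v) <= (f u \preceq f v).
Proof.
rewrite [leRHS]galois -[leLHS]lmul1r; apply: preceq_trans_le (lexx _) _.
by rewrite -galois lpreceq_refl.
Qed.

(** The adjunction removes [g]: symmetry becomes visible, and later bounds need only be proved for
    [f u \preceq v]. *)
Lemma galois_rel_symE u v : R (u, v) = Order.meet (f u \preceq v) (f v \preceq u).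
Proof. by rewrite /R /galois_rel /= -galois. Qed.

Lemma galois_rel_tolerance : ltolerance R.
Proof.
split=> [u|u v]; last by rewrite !galois_rel_symE meetC.
by rewrite galois_rel_symE (ext u).1 meetxx.
Qed.

Lemma galois_rel_compat : compatible (@lapprox _ _ U) R.
Proof.
have half u v u' v' :
    (f u \preceq v) \otimes (u \approx u') \otimes (v \approx v') <=
    (f u' \preceq v').
  apply: (preceq_trans_le (v := v)); last by rewrite approxE leIl.
  rewrite lmulC; apply: preceq_trans_le (lexx _).
  by apply: le_trans (f_mono u' u); rewrite approxE leIr.
move=> u v u' v'; rewrite !galois_rel_symE lexI; apply/andP; split.
  apply: le_trans (half u v u' v').
  by do 2!apply: lmul_mono => //; exact: leIl.
apply: le_trans (half v u v' u'); rewrite -!lmulA [X in _ \otimes X]lmulC.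
by apply: lmul_mono => //; exact: leIr.
Qed.

Let R_lower u v : R (u, v) <= (f u \preceq v). Proof. exact: leIl. Qed.

Let Rsym : lsymmetric R := proj2 galois_rel_tolerance.

(** Each [y] in [V2] is related to some [x] in [V1], to the degree given by the power relation, and
    then [f m1 \preceq f x] and [f x \preceq y] compose. *)
Lemma galois_rel_inf_preserving : inf_preserving R.
Proof.
have half V1 V2 m1 m2 : is_inf V1 m1 -> is_inf V2 m2 ->
    power_rel R V1 V2 <= (f m1 \preceq m2).
  move=> m1E /is_infP->; apply/bigmeetP => y; rewrite -lresiduation.
  apply: le_trans (lmul_mono (leIr _ _) (lexx _)) _.
  apply: le_trans (subsethood_mp _ _ _) _; apply: bigjoin_le => x.
  apply: preceq_trans_le (R_lower x y).
  exact: le_trans (is_inf_lb x m1E) (f_mono _ _).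
move=> V1 V2 m1 m2 m1E m2E; rewrite galois_rel_symE lexI half//=.
by rewrite power_rel_sym// half.
Qed.

Lemma galois_rel_sup_preserving : sup_preserving R.
Proof.
have half V1 V2 s1 s2 : is_sup V1 s1 -> is_sup V2 s2 ->
    power_rel R V1 V2 <= (f s1 \preceq s2).
  (* The adjunction frees [s1] from [f], so that its universal property applies; it is then undone
     at each [x]. *)
  move=> /is_supP s1E s2E; rewrite [leRHS]galois s1E.
  apply/bigmeetP => x; rewrite -lresiduation -galois.
  apply: le_trans (lmul_mono (leIl _ _) (lexx _)) _.
  apply: le_trans (subsethood_mp _ _ _) _; apply: bigjoin_le => y.
  exact: preceq_trans_le (R_lower x y) (is_sup_ub y s2E).
move=> V1 V2 s1 s2 s1E s2E; rewrite galois_rel_symE lexI half//=.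
by rewrite power_rel_sym// half.
Qed.

Lemma galois_rel_complete (HU : completely_lattice_ordered U) :
  complete_rel HU R.
Proof.
split; first exact: galois_rel_compat.
move=> V1 V2; split.
  by apply: galois_rel_inf_preserving; exact: inf_ofP.
by apply: galois_rel_sup_preserving; exact: sup_ofP.
Qed.

Lemma galois_rel_ctol (HU : completely_lattice_ordered U) :
  ltolerance R /\ complete_rel HU R.
Proof. by split; [exact: galois_rel_tolerance|exact: galois_rel_complete]. Qed.

Let lower_upper u : (f u \preceq g u) = \top.
Proof.
have [fu ug] := ext u; apply: eq_top; rewrite -[\top]lmul1l.
by apply: (preceq_trans_le (v := u)); [rewrite fu|rewrite ug].
Qed.

Lemma galois_rel_lower u : R (u, f u) = \top.
Proof. by rewrite /R /galois_rel /= lpreceq_refl lower_upper meetxx. Qed.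

Lemma galois_rel_upper u : R (u, g u) = \top.
Proof. by rewrite /R /galois_rel /= lpreceq_refl lower_upper meetxx. Qed.

(** [f u] and [g u] belong fully to the class of [u], hence are its least and greatest elements. *)
Lemma class_bounds_galois_rel (HU : completely_lattice_ordered U) :
  class_bounds HU R = fg.
Proof.
rewrite [RHS]surjective_pairing; congr pair; apply: funext => u.
  apply: is_inf_uniq (inf_ofP _ _) _.
  by apply: is_inf_min => [|v]; [exact: galois_rel_lower|exact: leIl].
apply: is_sup_uniq (sup_ofP _ _) _.
by apply: is_sup_max => [|v]; [exact: galois_rel_upper|exact: leIr].
Qed.

End GaloisToTolerance.

(** * Graded intersections of complete tolerances *)

Section CTolComplete.
Context {d : Order.disp_t} {L : completeResiduatedLatticeType d}.
Variables (U : lOrderedSet L) (HU : completely_lattice_ordered U).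
Variable V : lset L (CTol HU).

Definition ctol_bigcap_rel : lrel L U :=
  fun p => bigmeet (fun T : CTol HU => V T \imp sval T p).

Let bigcap_mp T p : ctol_bigcap_rel p \otimes V T <= sval T p.
Proof. by rewrite lresiduation; exact: bigmeet_le. Qed.

Lemma ctol_bigcap_compat : compatible (@lapprox _ _ U) ctol_bigcap_rel.
Proof.
move=> u v u' v'; apply/bigmeetP => T.
have [_ [Tcompat _]] := svalP T.
rewrite -lresiduation lmulC !lmulA; apply: le_trans (Tcompat u v u' v').
by do 2!apply: lmul_mono => //; rewrite lmulC.
Qed.

(** The factor [V T] distributes over the joins in the compositions, where it turns each degree of
    the intersection into a degree of [T]. Completeness of the intersection then follows by
    residuation. *)
Lemma power_rel_bigcap T V1 V2 :
  power_rel ctol_bigcap_rel V1 V2 \otimes V T <= power_rel (sval T) V1 V2.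
Proof.
rewrite lexI; apply/andP; split; apply/bigmeetP => x; rewrite -lresiduation.
  rewrite -lmulA (lmulC (V T)) lmulA lmulC.
  apply: (@le_trans _ _ (V T \otimes comp_left ctol_bigcap_rel V2 x)).
    apply: lmul_mono => //.
    exact: le_trans (lmul_mono (leIl _ _) (lexx _)) (subsethood_mp _ _ _).
  apply: lmul_bigjoin_le => y; apply: (le_bigjoin (x := y)).
  by rewrite lmulA; apply: lmul_mono => //; rewrite lmulC.
rewrite -lmulA (lmulC (V T)) lmulA lmulC.
apply: (@le_trans _ _ (V T \otimes comp_right V1 ctol_bigcap_rel x)).
  apply: lmul_mono => //.
  exact: le_trans (lmul_mono (leIr _ _) (lexx _)) (subsethood_mp _ _ _).
apply: lmul_bigjoin_le => y; apply: (le_bigjoin (x := y)).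
by rewrite lmulC -lmulA; apply: lmul_mono.
Qed.

Lemma ctol_bigcap_ctol :
  ltolerance ctol_bigcap_rel /\ complete_rel HU ctol_bigcap_rel.
Proof.
split; split.
- move=> u; apply: eq_top; apply/bigmeetP => T.
  by have [[-> _] _] := svalP T; rewrite -lresiduation lex1.
- move=> u v; congr bigmeet; apply: funext => T.
  by have [[_ ->] _] := svalP T.
- exact: ctol_bigcap_compat.
- move=> V1 V2; split; apply/bigmeetP => T; rewrite -lresiduation;
    apply: le_trans (power_rel_bigcap _ _ _) _;
    by have [_ [_ /(_ V1 V2)[]]] := svalP T.
Qed.

Definition ctol_bigcap : CTol HU := exist _ ctol_bigcap_rel ctol_bigcap_ctol.

(** Both sides are meets over all [T] and all [p], taken in opposite orders and matched by
    residuation. *)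
Lemma is_inf_ctol_bigcap : is_inf V ctol_bigcap.
Proof.
apply/is_infP => Q; apply/eqP; rewrite eq_le; apply/andP; split.
  apply/bigmeetP => T; rewrite -lresiduation; apply/bigmeetP => p.
  rewrite -lresiduation -lmulA (lmulC (V T)) lmulA.
  apply: le_trans (bigcap_mp T p); apply: lmul_mono => //.
  exact: subsethood_mp.
apply/bigmeetP => p; rewrite -lresiduation; apply/bigmeetP => T.
rewrite -lresiduation -lmulA (lmulC (sval Q p)) lmulA.
apply: le_trans (subsethood_mp (sval Q) (sval T) p); apply: lmul_mono => //.
by rewrite lresiduation; exact: bigmeet_le.
Qed.

End CTolComplete.

Lemma CTol_completely_lattice_ordered (d : Order.disp_t)
    (L : completeResiduatedLatticeType d) (U : lOrderedSet L)
    (HU : completely_lattice_ordered U) :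
  completely_lattice_ordered (CTol HU).
Proof.
apply: completely_lattice_ordered_inf => V.
by exists (ctol_bigcap V); exact: is_inf_ctol_bigcap.
Qed.

(** Transitivity gives one inequality. For the other, inclusion is evaluated at [u] paired with its
    lower and upper images under [c1], where the first relation is [\top]. *)
Lemma eigal_preceqE (d : Order.disp_t) (L : completeResiduatedLatticeType d)
    (U : lOrderedSet L) (c1 c2 : EIGal U) :
  (c1 \preceq c2) = subsethood (galois_rel (sval c1)) (galois_rel (sval c2)).
Proof.
have [[ext1 ext2] [gal1 gal2]] : (extensive (sval c1) /\ extensive (sval c2)) /\
    (isotone_galois (sval c1) /\ isotone_galois (sval c2)).
  by case: (svalP c1) (svalP c2) => [? ?] [? ?].
apply/eqP; rewrite eq_le; apply/andP; split.
  apply/bigmeetP => -[u v]; rewrite -lresiduation lexI; apply/andP; split.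
    apply: preceq_trans_le (leIl _ _).
    exact: le_trans (leIl _ _) (bigmeet_le _ u).
  rewrite lmulC; apply: preceq_trans_le (leIr _ _) _.
  exact: le_trans (leIr _ _) (bigmeet_le _ u).
rewrite lexI; apply/andP; split; apply/bigmeetP => u.
  apply: le_trans (bigmeet_le _ (u, (sval c1).1 u)) _.
  by rewrite galois_rel_lower// limp1l leIl.
apply: le_trans (bigmeet_le _ (u, (sval c1).2 u)) _.
by rewrite galois_rel_upper// limp1l leIr.
Qed.

Theorem theorem16 (d : Order.disp_t) (L : completeResiduatedLatticeType d)
  (U : lOrderedSet L) (HU : completely_lattice_ordered U) :
  (exists (h : CTol HU -> EIGal U) (k : EIGal U -> CTol HU),
     (forall R : CTol HU, sval (h R) = class_bounds HU (sval R)) /\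
     (forall c : EIGal U, sval (k c) = galois_rel (sval c)) /\
     lisomorphism h /\ cancel h k /\ cancel k h) /\
  completely_lattice_ordered (CTol HU) /\
  completely_lattice_ordered (EIGal U).
Proof.
pose h (R : CTol HU) : EIGal U := exist _ (class_bounds HU (sval R))
  (class_bounds_eigal (svalP R).1 (svalP R).2).
pose k (c : EIGal U) : CTol HU := exist _ (galois_rel (sval c))
  (galois_rel_ctol (svalP c).1 (svalP c).2 HU).
have hK : cancel h k.
  by case=> R [Rtol Rc]; apply: eq_exist => /=; exact: galois_rel_class_bounds.
have kK : cancel k h.
  by case=> fg [gal ext]; apply: eq_exist => /=; exact: class_bounds_galois_rel.
(* By [hK], [R1] and [R2] are the Galois relations of [h R1] and [h R2], whose subsethood is the
   order of [EIGal U]. *)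
have hP R1 R2 : (R1 \preceq R2) = (h R1 \preceq h R2).
  by rewrite [RHS]eigal_preceqE -[in LHS](hK R1) -[in LHS](hK R2).
split; first by exists h, k; do !split=> //; exists k.
split; first exact: CTol_completely_lattice_ordered.
apply: completely_lattice_ordered_iso hK kK hP _.
exact: CTol_completely_lattice_ordered.
Qed.
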